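(* Let $G$ be a graph with $m\geq 1$ edges. Then $$col(G)\leq \frac{2m}{\sqrt{s^+}}\leq \frac{2m}{\mu}\leq 2R(G).$$
   Context: Graphs are finite, simple and undirected, and $d(u)$ denotes the degree of a vertex $u$ in $G$. The coloring number $col(G)$ is the smallest integer $k$ for which there exists a linear ordering of the vertices of $G$ such that each vertex is preceded by fewer than $k$ of its neighbors. Let $\mu=\mu_1\geq\cdots\geq\mu_n$ be the eigenvalues (with multiplicity) of the adjacency matrix of $G$, where $n$ is the number of vertices of $G$, and let $\pi$ be the number of positive eigenvalues (counting multiplicities). Then $s^+=\sum_{i=1}^{\pi}\mu_i^2$ is the sum of the squares of the positive eigenvalues. The Randić index of $G$ is $R(G)=\sum_{uv\in E(G)}\frac{1}{\sqrt{d(u)d(v)}}$. *)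

(* Defs.v *)
From HB Require Import structures.
From mathcomp Require Import all_boot all_order all_algebra.
From mathcomp Require Import polyrcf.

Set Implicit Arguments.
Unset Strict Implicit.
Unset Printing Implicit Defensive.

Import Order.TTheory GRing.Theory Num.Theory.

Local Open Scope ring_scope.

(* A finite simple graph is given by its adjacency relation e : rel T on a
   finite vertex type T, assumed symmetric and irreflexive where needed. *)

Section Graph.

Variables (T : finType) (e : rel T).

Definition deg (u : T) : nat := #|[set v | e u v]|.

Definition edges : {set {set T}} :=
  [set E : {set T} | [exists u, exists v, e u v && (E == [set u; v])]].

Definition linear_ordering (s : #|T|.-tuple T) : bool := uniq s.

Definition preceding_nbrs (s : #|T|.-tuple T) (v : T) : {set T} :=
  [set u | e u v & (index u s < index v s)%N].

Definition col_bound (k : nat) : bool :=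
  [exists s : #|T|.-tuple T,
     linear_ordering s && [forall v, #|preceding_nbrs s v| < k]%N].

Lemma col_bound_ex : exists k, col_bound k.
Proof.
exists #|T|.+1; apply/existsP; exists (enum_tuple T).
rewrite /linear_ordering enum_uniq /=.
by apply/forallP => v; rewrite ltnS max_card.
Qed.

Definition coloring_number : nat := ex_minn col_bound_ex.

Definition adjmx (R : pzSemiRingType) : 'M[R]_#|T| :=
  \matrix_(i, j) (e (enum_val i) (enum_val j))%:R.

(* An edge {u, v} has two distinct elements when e is irreflexive, so the
   product over w \in E is d(u) d(v). *)
Definition randic (R : rcfType) : R :=
  \sum_(E in edges) (Num.sqrt (\prod_(w in E) (deg w)%:R))^-1.

End Graph.

(* The eigenvalues in R of A, in nonincreasing order, each repeated according
   to its multiplicity as a root of the characteristic polynomial. For a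
   symmetric A all n eigenvalues lie in R, so this list has length n. *)
Definition spectrum (R : rcfType) (n : nat) (A : 'M[R]_n) : seq R :=
  flatten [seq nseq (mup x (char_poly A)) x | x <- rev (rootsR (char_poly A))].

Lemma mem_rootsR_char (R : rcfType) (n : nat) (A : 'M[R]_n) (x : R) :
  (x \in rootsR (char_poly A)) = root (char_poly A) x.
Proof.
have p0 : char_poly A != 0 by rewrite monic_neq0 ?char_poly_monic.
by rewrite -(roots_on_rootsR p0) in_itv.
Qed.

Lemma count_spectrum (R : rcfType) (n : nat) (A : 'M[R]_n) (x : R) :
  count_mem x (spectrum A) = mup x (char_poly A).
Proof.
rewrite /spectrum; set p := char_poly A.
have ur : uniq (rev (rootsR p)).
  by rewrite rev_uniq; apply: sorted_uniq lt_trans ltxx _ (sorted_roots _ _ _).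
rewrite count_flatten -map_comp sumnE big_map.
have [xr|xr] := boolP (x \in rev (rootsR p)).
  rewrite (bigD1_seq x) //= count_nseq /= eqxx mul1n big1 ?addn0 // => y yx.
  by rewrite count_nseq /= (negPf yx).
rewrite mupNroot; last by move: xr; rewrite mem_rev mem_rootsR_char.
rewrite big_seq big1 // => y yr /=; rewrite count_nseq /=.
by case: eqP yr xr => // -> ->.
Qed.

Lemma mem_spectrum (R : rcfType) (n : nat) (A : 'M[R]_n) (x : R) :
  (x \in spectrum A) = eigenvalue A x.
Proof.
have p0 : char_poly A != 0 by rewrite monic_neq0 ?char_poly_monic.
rewrite -has_pred1 has_count count_spectrum -XsubC_dvd // dvdp_XsubCl.
by rewrite eigenvalue_root_char.
Qed.

Lemma sorted_spectrum (R : rcfType) (n : nat) (A : 'M[R]_n) :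
  sorted >=%R (spectrum A).
Proof.
have tr : transitive (>=%R : rel R) by move=> y x z xy yz; apply: le_trans xy.
rewrite /spectrum; set p := char_poly A.
have : pairwise >=%R (rev (rootsR p)).
  rewrite -sorted_pairwise // rev_sorted.
  exact: sub_sorted (@ltW _ _) _ (sorted_roots _ _ _).
rewrite sorted_pairwise //.
elim: (rev _) => //= x r IH /andP[/allP xr /IH pr].
rewrite pairwise_cat pr andbT; apply/andP; split.
  apply/allrelP => y z /nseqP[-> _] /flatten_mapP[w wr /nseqP[-> _]].
  exact: xr.
by elim: (mup x p) => //= k ->; rewrite andbT all_nseq /= lexx orbT.
Qed.

Definition mu (R : rcfType) (T : finType) (e : rel T) : R :=
  head 0 (spectrum (adjmx e R)).

Definition splus (R : rcfType) (T : finType) (e : rel T) : R :=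
  \sum_(x <- spectrum (adjmx e R) | 0 < x) x ^+ 2.

(* Main.v *)
Require Import Defs.
From mathcomp Require Import all_boot all_order all_algebra.
From mathcomp Require Import sesquilinear spectral polyrcf complex ring.
Import Order.TTheory GRing.Theory Num.Theory.
Local Open Scope ring_scope.

(** The first inequality is the only deep one. Put k = col(G). Two facts are
    combined:

    - coloring the vertices greedily along an optimal ordering gives a proper
      k-coloring, and for every k-colorable graph the theorem of Ando and Lin
      gives k s^+ <= (k - 1) 2m ([splus_le_ando_lin]);
    - by minimality of k, some nonempty vertex set S induces a subgraph of
      minimum degree at least k - 1; hence S has at least k elements and
      k (k - 1) <= 2m by counting degrees ([coloring_number_edges]).

    Therefore k^2 s^+ <= k (k - 1) 2m <= (2m)^2.

    The Ando-Lin theorem is proved as follows. Write the adjacency matrix as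
    A = X - Y with X and Y its positive and negative parts, so that XY = 0, and
    let a, b be the squared Hilbert-Schmidt norms of X and Y; then a = s^+ and
    a + b = 2m. Cut the matrices into blocks along the color classes. The
    diagonal blocks of A vanish, so X and Y have the same diagonal blocks; let
    D be the part of a (equally, of b) carried by them. Positivity of X gives
    a <= k D ([gram_pinching]). The diagonal blocks of X + (k - 1) Y are k times
    those of X, so that k^2 D is at most the squared norm of X + (k - 1) Y,
    which is a + (k - 1)^2 b by orthogonality. Eliminating D leaves
    a <= (k - 1) b.

    The second inequality says that mu^2 is one of the terms of s^+, once mu is
    known to be positive. For the last one, evaluate the Rayleigh quotient of A
    at the vector with entries sqrt(d(u)): the sum S of sqrt(d(u) d(v)) over
    ordered pairs of adjacent vertices is at most 2m mu. This also shows
    mu > 0. Summing q - 2 mu + mu^2 / q >= 0 over the same pairs, with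
    q = sqrt(d(u) d(v)), turns it into m <= mu R(G). *)

Set Implicit Arguments.
Unset Strict Implicit.
Unset Printing Implicit Defensive.

Local Open Scope sesquilinear_scope.

(** * Positive semidefinite matrices with common diagonal blocks *)

Section HilbertSchmidt.
Variable C : numClosedFieldType.

(** The squared Hilbert-Schmidt (Frobenius) norm. *)
Definition hs m n (M : 'M[C]_(m, n)) : C := \tr (M *m M^t*).

Lemma hsE m n (M : 'M[C]_(m, n)) : hs M = \sum_i \sum_j `|M i j| ^+ 2.
Proof.
apply: eq_bigr => i _; rewrite mxE; apply: eq_bigr => j _.
by rewrite !mxE normCK.
Qed.

Lemma trCmx_mul m n p (A : 'M[C]_(m, n)) (B : 'M[C]_(n, p)) :
  (A *m B)^t* = B^t* *m A^t*.
Proof. by rewrite trmx_mul map_mxM. Qed.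

Lemma hs_gram m n (W : 'M[C]_(m, n)) : hs (W^t* *m W) = hs (W *m W^t*).
Proof. by rewrite /hs !trCmx_mul !trmxCK -mulmxA mxtrace_mulC !mulmxA. Qed.

Lemma hs_pythagoras m n (X Y : 'M[C]_(m, n)) (t : C) :
  X *m Y^t* = 0 -> hs (X + t *: Y) = hs X + `|t| ^+ 2 * hs Y.
Proof.
move=> XY0; have YX0 : Y *m X^t* = 0.
  by rewrite -[Y]trmxCK -trCmx_mul XY0 trmx0 map_mx0.
rewrite /hs linearD linearZ /= map_mxD map_mxZ mulmxDl !mulmxDr.
by rewrite -!scalemxAl -!scalemxAr XY0 YX0 !scaler0 addr0 add0r scalerA -normCK
           mxtraceD mxtraceZ.
Qed.

Lemma sqr_norm_sum_le k (z : 'I_k -> C) :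
  `|\sum_a z a| ^+ 2 <= k%:R * \sum_a `|z a| ^+ 2.
Proof.
have le_sum : `|\sum_a z a| ^+ 2 <= (\sum_a `|z a|) ^+ 2.
  by rewrite lerXn2r ?nnegrE ?sumr_ge0 ?ler_norm_sum.
apply: le_trans le_sum _.
(* 2 |z a| |z b| <= |z a|^2 + |z b|^2, summed over all pairs. *)
rewrite -(ler_pM2l (ltr0Sn C 1)) expr2 big_distrlr /= mulr_sumr.
have -> : 2 * (k%:R * \sum_a `|z a| ^+ 2) =
    \sum_(a < k) \sum_(b < k) (`|z a| ^+ 2 + `|z b| ^+ 2).
  under [RHS]eq_bigr do rewrite big_split sumr_const card_ord /=.
  by rewrite big_split sumr_const /= card_ord sumrMnl -[_ *+ k]mulr_natl; ring.
apply: ler_sum => a _; rewrite mulr_sumr; apply: ler_sum => b _.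
rewrite -subr_ge0.
have -> : `|z a| ^+ 2 + `|z b| ^+ 2 - 2 * (`|z a| * `|z b|) =
  (`|z a| - `|z b|) ^+ 2 by ring.
by rewrite -realEsqr rpredB ?normr_real.
Qed.

Lemma hs_sum_le m n k (M : 'I_k -> 'M[C]_(m, n)) :
  hs (\sum_a M a) <= k%:R * \sum_a hs (M a).
Proof.
rewrite (eq_bigr _ (fun a _ => hsE (M a))) hsE.
rewrite [X in _ * X]exchange_big mulr_sumr.
apply: ler_sum => i _.
rewrite [X in _ * X]exchange_big mulr_sumr; apply: ler_sum => j _.
by rewrite summxE sqr_norm_sum_le.
Qed.

Section Coloring.
Variables (n k : nat) (c : 'I_n -> 'I_k).

(** With rows and columns grouped by color, [hs_diag M] is the contribution of
    the diagonal blocks to [hs M]. *)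
Definition hs_diag (M : 'M[C]_n) : C :=
  \sum_i \sum_(j | c j == c i) `|M i j| ^+ 2.

Lemma hs_diag_le M : hs_diag M <= hs M.
Proof.
rewrite hsE; apply: ler_sum => i _.
rewrite [leRHS](bigID (fun j => c j == c i)).
by rewrite lerDl sumr_ge0 // => j _; rewrite exprn_ge0.
Qed.

(** The pinching inequality: a positive semidefinite matrix is at most k times
    its block diagonal part. For X = W^* W the trace identity [hs_gram] moves
    the problem to W W^*, which is the sum over the k colors a of
    W_a W_a^*, where W_a keeps the columns of color a; Cauchy-Schwarz over the
    k colors then costs a factor k, and moving back turns the summands into
    the diagonal blocks of X. *)
Lemma gram_pinching m (W : 'M[C]_(m, n)) :
  hs (W^t* *m W) <= k%:R * hs_diag (W^t* *m W).
Proof.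
pose Wc a : 'M_(m, n) := \matrix_(i, j) (W i j *+ (c j == a)).
have -> : hs (W^t* *m W) = hs (\sum_a Wc a *m (Wc a)^t*).
  rewrite hs_gram; congr hs; apply/matrixP => i j.
  rewrite summxE; under [RHS]eq_bigr do rewrite mxE.
  rewrite exchange_big mxE; apply: eq_bigr => u _.
  rewrite (bigD1 (c u)) //= big1 ?addr0 => [|a /negPf ac].
    by rewrite !mxE eqxx.
  by rewrite !mxE eq_sym ac mul0r.
apply: le_trans (hs_sum_le _) _; rewrite ler_wpM2l //.
rewrite (eq_bigr _ (fun a _ => esym (hs_gram (Wc a)))).
rewrite (eq_bigr _ (fun a _ => hsE _)) exchange_big; apply: ler_sum => i _.
rewrite exchange_big [leRHS]big_mkcond; apply: ler_sum => j _ /=.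
rewrite (bigD1 (c i)) //= big1 ?addr0 => [|a /negPf ac]; last first.
  rewrite !mxE big1 ?normr0 ?expr0n // => u _.
  by rewrite !mxE eq_sym ac rmorph0 mul0r.
rewrite !mxE; case: eqP => cji.
  rewrite le_eqVlt; apply/orP; left; apply/eqP; congr (`|_| ^+ 2).
  by apply: eq_bigr => u _; rewrite !mxE cji eqxx.
rewrite big1 ?normr0 ?expr0n // => u _.
by rewrite !mxE (negPf (introN eqP cji)) mulr0.
Qed.

(** The matrix inequality behind the Ando-Lin theorem. Comparing the diagonal
    blocks of X + (k - 1) Y with the whole matrix avoids any estimate of the
    inner product of the off-diagonal parts of X and Y. *)
Lemma ando_lin_gram m p (W : 'M[C]_(m, n)) (V : 'M[C]_(p, n)) :
    (1 < k)%N -> (W^t* *m W) *m (V^t* *m V) = 0 ->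
    (forall i j, c j = c i -> (W^t* *m W) i j = (V^t* *m V) i j) ->
  k%:R * hs (W^t* *m W)
    <= (k%:R - 1) * (hs (W^t* *m W) + hs (V^t* *m V)).
Proof.
set X := W^t* *m W; set Y := V^t* *m V => k1 XY0 XYdiag.
have YH : Y^t* = Y by rewrite /Y trCmx_mul trmxCK.
have leX : hs X <= k%:R * hs_diag X := gram_pinching W.
have k1_gt0 : 0 < k%:R - 1 :> C by rewrite subr_gt0 ltr1n.
have := hs_diag_le (X + (k%:R - 1) *: Y).
rewrite hs_pythagoras ?YH // (ger0_norm (ltW k1_gt0)).
have -> : hs_diag (X + (k%:R - 1) *: Y) = k%:R ^+ 2 * hs_diag X.
  rewrite mulr_sumr; apply: eq_bigr => i _; rewrite mulr_sumr.
  apply: eq_bigr => j /eqP cji; rewrite [in LHS]mxE [((k%:R - 1) *: Y) i j]mxE.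
  have -> : X i j + (k%:R - 1) * Y i j = k%:R * X i j.
    by rewrite -XYdiag //; ring.
  by rewrite normrM exprMn normr_nat.
move=> leD; suff leXY : hs X <= (k%:R - 1) * hs Y.
  have -> : k%:R * hs X = (k%:R - 1) * hs X + hs X by ring.
  by rewrite mulrDr lerD2l.
(* k (hs X) <= k^2 (hs_diag X) <= hs X + (k - 1)^2 (hs Y). *)
rewrite -(ler_pM2l k1_gt0) mulrA -expr2.
rewrite -(lerD2l (hs X)); apply: le_trans leD.
have -> : hs X + (k%:R - 1) * hs X = k%:R * hs X by ring.
by rewrite expr2 -mulrA ler_wpM2l.
Qed.

End Coloring.
End HilbertSchmidt.

(** * Spectral theory of real symmetric matrices *)

Lemma char_poly_conj (F : fieldType) n (P D : 'M[F]_n) : P \in unitmx ->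
  char_poly (invmx P *m D *m P) = char_poly D.
Proof.
move=> Pu; rewrite /char_poly; pose up := @map_mx _ _ (@polyC F) n n.
have -> : char_poly_mx (invmx P *m D *m P) =
    up (invmx P) *m char_poly_mx D *m up P.
  rewrite /char_poly_mx mulmxBr mulmxBl /up !map_mxM scalar_mxC.
  rewrite -['X%:M *m _ *m _]mulmxA -[map_mx _ (invmx P) *m map_mx _ P]map_mxM.
  by rewrite mulVmx // map_mx1 mulmx1.
rewrite !det_mulmx mulrAC -det_mulmx /up -map_mxM mulVmx //.
by rewrite map_mx1 det1 mul1r.
Qed.

Section RealSpectrum.
Variable R : rcfType.
Local Notation toC := (real_complex R).

Let conj_real z : (toC z)^* = toC z.
Proof. exact: conjc_real. Qed.

Variables (n : nat) (A : 'M[R]_n).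
Hypothesis A_sym : A^T = A.

(** The spectral theorem over an algebraically closed field is applied to A seen
    as a Hermitian matrix over R[i]. The eigenvectors it gives are complex, but
    the eigenvalues are real, and the characteristic polynomial identifies them
    with the entries of [spectrum A]. *)
Lemma spectral_real : exists (P : 'M[R[i]]_n) (d : 'I_n -> R),
  [/\ P *m P^t* = 1%:M, P^t* *m P = 1%:M,
      map_mx toC A = P^t* *m diag_mx (\row_i toC (d i)) *m P &
      perm_eq (spectrum A) (codom d)].
Proof.
pose AC := map_mx toC A; pose P := spectralmx AC.
have AH : AC \is hermsymmx.
  apply: realsym_hermsym; last first.
    by apply/mxOverP => i j; rewrite mxE; apply/complex_realP; exists (A i j).
  apply/is_hermitianmxP; rewrite expr0 scale1r map_mx_id //.
  by rewrite /AC map_trmx A_sym.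
have Pun : P \is unitarymx := spectral_unitarymx AC.
have PP : P *m P^t* = 1%:M by apply/unitarymxP.
have P'P : P^t* *m P = 1%:M.
  by rewrite -invmx_unitary // mulVmx // unitarymx_unit.
pose d i := complex.Re (spectral_diag AC 0 i).
have dE : \row_i toC (d i) = spectral_diag AC.
  apply/rowP => i; rewrite mxE; apply: RRe_real.
  exact: (mxOverP (hermitian_spectral_diag_real AH)).
have AE : AC = P^t* *m diag_mx (\row_i toC (d i)) *m P.
  rewrite dE -invmx_unitary //.
  exact/orthomx_spectralP/hermitian_normalmx.
exists P, d; split=> //.
have cA : char_poly A = \prod_(x <- codom d) ('X - x%:P).
  apply: (map_poly_inj toC); rewrite map_char_poly -/AC AE -invmx_unitary //.
  rewrite char_poly_conj ?unitarymx_unit // char_poly_trig ?diag_mx_is_trig //.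
  rewrite big_image rmorph_prod; apply: eq_bigr => i _ /=.
  by rewrite rmorphB /= map_polyX map_polyC !mxE eqxx.
apply/allP => x _ /=; apply/eqP.
by rewrite count_spectrum cA mu_prod_XsubC.
Qed.

Lemma rayleigh_le (x : 'I_n -> R) :
  \sum_i \sum_j x i * A i j * x j <= head 0 (spectrum A) * \sum_i x i ^+ 2.
Proof.
have [P [d [PP P'P AE dA]]] := spectral_real.
set mu1 := head 0 _.
have led i : d i <= mu1.
  have : d i \in spectrum A by rewrite (perm_mem dA) codom_f.
  have := sorted_spectrum A; rewrite /mu1; case: (spectrum A) => //= y s.
  rewrite path_sortedE; last by move=> ? ? ? h1 h2; apply: le_trans h1.
  by case/andP => /allP ys _; rewrite inE => /orP[/eqP->//|/ys].
pose v : 'cV[R[i]]_n := \col_i toC (x i).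
pose y := P *m v.
have vE : v^t* *m v = y^t* *m y.
  by rewrite /y trCmx_mul mulmxA -[_ *m P]mulmxA P'P mulmx1.
have vAE : v^t* *m map_mx toC A *m v = y^t* *m diag_mx (\row_i toC (d i)) *m y.
  by rewrite /y trCmx_mul AE !mulmxA.
have E1 : (v^t* *m map_mx toC A *m v) 0 0 =
    toC (\sum_i \sum_j x i * A i j * x j).
  rewrite exchange_big rmorph_sum mxE; apply: eq_bigr => j _.
  rewrite mxE mulr_suml rmorph_sum; apply: eq_bigr => i _.
  by rewrite !mxE conj_real !rmorphM.
have E2 : (v^t* *m v) 0 0 = toC (\sum_i x i ^+ 2).
  rewrite mxE rmorph_sum; apply: eq_bigr => j _.
  by rewrite !mxE conj_real -expr2 rmorphXn.
rewrite -lecR rmorphM /= -E1 -E2 vE vAE !mxE mulr_sumr; apply: ler_sum => i _.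
rewrite mul_mx_diag !mxE mulrAC [leRHS]mulrC ler_wpM2l ?lecR //.
by rewrite mulrC -normCK exprn_ge0.
Qed.

(** Ando-Lin for a real symmetric matrix whose diagonal blocks vanish. The
    positive and negative parts of A are the Gram matrices of W dp and W dn,
    where dp and dn are the positive and negative parts of the eigenvalues. *)
Lemma ando_lin k (c : 'I_n -> 'I_k) : (1 < k)%N ->
    (forall i j, c i = c j -> A i j = 0) ->
  k%:R * \sum_(x <- spectrum A | 0 < x) x ^+ 2
    <= (k%:R - 1) * \sum_i \sum_j A i j ^+ 2.
Proof.
move=> k1 Ac; have [P [d [PP P'P AE dA]]] := spectral_real.
pose W (f : 'I_n -> R) := diag_mx (\row_i toC (Num.sqrt (f i))) *m P.
have WE f : (forall i, 0 <= f i :> R) ->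
    (W f)^t* *m W f = P^t* *m diag_mx (\row_i toC (f i)) *m P.
  move=> f0; rewrite /W trCmx_mul !mulmxA; congr (_ *m _); rewrite -mulmxA.
  congr (_ *m _); rewrite tr_diag_mx map_diag_mx mulmx_diag; congr diag_mx.
  apply/rowP => i; rewrite !mxE /= conj_real -rmorphM.
  by rewrite -expr2 sqr_sqrtr.
have hsW f : (forall i, 0 <= f i :> R) ->
    hs ((W f)^t* *m W f) = toC (\sum_i f i ^+ 2).
  move=> f0; rewrite hs_gram /W trCmx_mul -mulmxA [P *m _]mulmxA PP mul1mx.
  rewrite tr_diag_mx map_diag_mx mulmx_diag hsE rmorph_sum.
  apply: eq_bigr => i _.
  rewrite (bigD1 i) //= big1 => [|j /negPf ji].
    rewrite !mxE eqxx mulr1n /= conj_real -rmorphM -expr2.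
    by rewrite sqr_sqrtr // addr0 ger0_norm ?lecR // rmorphXn.
  by rewrite !mxE eq_sym ji mulr0n normr0 expr0n.
pose dp i := Num.max (d i) 0; pose dn i := Num.max (- d i) 0.
have dp0 i : 0 <= dp i by rewrite le_max lexx orbT.
have dn0 i : 0 <= dn i by rewrite le_max lexx orbT.
have dpn i : dp i * dn i = 0.
  rewrite /dp /dn; case: (lerP (d i) 0) => [d0|d0]; first by rewrite mul0r.
  by rewrite max_r ?mulr0 // oppr_le0 ltW.
have dBn i : dp i - dn i = d i.
  rewrite /dp /dn; case: (lerP (d i) 0) => d0.
    by rewrite max_l ?oppr_ge0 // opprK add0r.
  by rewrite max_r ?subr0 // oppr_le0 ltW.
set X := (W dp)^t* *m W dp; set Y := (W dn)^t* *m W dn.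
have XY0 : X *m Y = 0.
  rewrite /X /Y !WE // !mulmxA -[_ *m P *m P^t*]mulmxA PP mulmx1.
  rewrite -[_ *m diag_mx _ *m diag_mx _]mulmxA mulmx_diag.
  suff -> : \row_j ((\row_i toC (dp i)) 0 j * (\row_i toC (dn i)) 0 j) =
      0 :> 'rV_n.
    by rewrite linear0 mulmx0 mul0mx.
  by apply/rowP => i; rewrite !mxE -rmorphM /= dpn.
have YH : Y^t* = Y by rewrite /Y trCmx_mul trmxCK.
have XBY : X + (-1) *: Y = map_mx toC A.
  rewrite scaleN1r /X /Y !WE // -mulmxBl -mulmxBr AE -linearB.
  congr (_ *m diag_mx _ *m _).
  by apply/rowP => i; rewrite !mxE -rmorphB /= dBn.
have hsA : toC (\sum_i \sum_j A i j ^+ 2) = hs X + hs Y.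
  have -> : hs X + hs Y = hs (X + (-1) *: Y).
    by rewrite hs_pythagoras ?YH // normrN1 expr1n mul1r.
  rewrite XBY hsE rmorph_sum; apply: eq_bigr => i _; rewrite rmorph_sum.
  apply: eq_bigr => j _; rewrite mxE rmorphXn /= real_normK //.
  by apply/complex_realP; exists (A i j).
have XYdiag i j : c j = c i -> X i j = Y i j.
  move=> cji; apply/eqP; rewrite -subr_eq0 -mulN1r.
  have /matrixP/(_ i j) := XBY; rewrite [LHS]mxE [((-1) *: Y) i j]mxE => ->.
  by rewrite mxE Ac.
have -> : \sum_(x <- spectrum A | 0 < x) x ^+ 2 = \sum_i dp i ^+ 2.
  rewrite (perm_big _ dA) big_image_cond big_mkcond; apply: eq_bigr => i _.
  by rewrite /dp; case: (lerP (d i) 0) => //; rewrite expr0n.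
rewrite -lecR !rmorphM rmorphB rmorph1 rmorph_nat /= hsA -hsW // -/X.
exact: ando_lin_gram k1 XY0 XYdiag.
Qed.

End RealSpectrum.

(** * Colorings and vertex orderings *)

Section Graph.
Variables (T : finType) (e : rel T).
Hypotheses (e_sym : symmetric e) (e_irr : irreflexive e).

(** An edge is the image of exactly two ordered pairs, by symmetry and
    irreflexivity. *)
Lemma sum_arcs (V : nmodType) (F : {set T} -> V) :
  \sum_u \sum_(v | e u v) F [set u; v] = (\sum_(E in edges e) F E) *+ 2.
Proof.
rewrite pair_big_dep /=.
rewrite (partition_big (fun p => [set p.1; p.2]) (mem (edges e))) /=.
  rewrite -sumrMnl; apply: eq_bigr => E.
  rewrite inE => /existsP[u /existsP[v /andP[uv /eqP->]]] {E}.
  have Nuv : u != v by apply: contraTneq uv => ->; rewrite e_irr.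
  rewrite (bigD1 (u, v)) /=; last by rewrite uv eqxx.
  rewrite (bigD1 (v, u)) /=; last first.
    by rewrite e_sym uv setUC eqxx xpair_eqE negb_and eq_sym Nuv.
  rewrite [[set v; u]]setUC big1 ?addr0 // => -[a b] /= /andP[/andP[/andP[ab]]].
  move=> /eqP Eab Nuv1 Nvu1.
  have : a \in [set u; v] by rewrite -Eab !inE eqxx.
  have : b \in [set u; v] by rewrite -Eab !inE eqxx orbT.
  case/set2P=> bE; case/set2P=> aE; move: ab Nuv1 Nvu1; rewrite {}aE {}bE.
  - by rewrite e_irr.
  - by rewrite !eqxx.
  - by rewrite !eqxx.
  - by rewrite e_irr.
move=> [a b] /= ab; rewrite inE; apply/existsP; exists a.
by apply/existsP; exists b; rewrite ab eqxx.
Qed.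

Lemma sum_deg : (\sum_u deg e u = 2 * #|edges e|)%N.
Proof.
have := sum_arcs (fun=> 1%N); rewrite sum1_card => E.
rewrite mul2n -addnn -[RHS]E; apply: eq_bigr => u _.
by rewrite sum1_card; apply: eq_card => v; rewrite !inE.
Qed.

(** Color the vertices in the given order: at most k colors are used on the
    preceding neighbours of a vertex, so one of the k + 1 colors is free. *)
Lemma greedy_coloring k : col_bound e k.+1 ->
  exists c : T -> 'I_k.+1, forall u v, e u v -> c u != c v.
Proof.
case/existsP => s /andP[us /forallP sk].
have sT u : u \in s.
  have sT : #|s| = #|T| by rewrite (card_uniqP us) size_tuple.
  by have /(subset_cardP sT) -> : s \subset T by exact: subset_predT.
have ltT u : (index u s < #|T|)%N
  by have := sT u; rewrite -index_mem size_tuple.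
(* Color the vertices whose position in s is less than j, by induction on j. *)
suff /(_ #|T|) [c cP] : forall j, exists c : T -> 'I_k.+1,
    forall u v, e u v -> (index u s < j)%N -> (index v s < j)%N -> c u != c v.
  by exists c => u v uv; apply: cP.
elim=> [|j [c cP]]; first by exists (fun=> ord0).
have [js|js] := ltnP j #|T|; last first.
  by exists c => u v uv _ _; apply: cP uv _ _; apply: leq_trans js.
have [w iw] : exists w, index w s = j.
  have /card_gt0P[w0 _] : (0 < #|T|)%N by apply: leq_ltn_trans js.
  by exists (nth w0 s j); rewrite index_uniq // size_tuple.
have [a aP] : exists a, a \notin [set c u | u in preceding_nbrs e s w].
  apply/existsP; rewrite -negb_forall; apply/negP => /forallP all_a.
  have := leq_ltn_trans (leq_imset_card c (mem (preceding_nbrs e s w))) (sk w).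
  rewrite ltnNge -[X in (X <= _)%N]card_ord => /negP[]; apply: subset_leq_card.
  by apply/subsetP => a _; exact: all_a.
have idx u : (index u s < j.+1)%N -> u != w -> (index u s < j)%N.
  rewrite ltnS leq_eqVlt => /orP[/eqP iu /eqP[]|//].
  exact: index_inj (sT u) (sT w) (etrans iu (esym iw)).
exists (fun u => if u == w then a else c u) => u v uv iu iv.
have [uw|Nuw] := eqVneq u w; have [vw|Nvw] := eqVneq v w.
- by move: uv; rewrite uw vw e_irr.
- apply: contraNneq aP => ->; apply: imset_f; rewrite inE e_sym -uw uv /=.
  by rewrite uw iw idx.
- rewrite eq_sym; apply: contraNneq aP => ->; apply: imset_f.
  rewrite inE -vw uv /=.
  by rewrite vw iw idx.
- by apply: cP; rewrite ?idx.
Qed.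

(** The ordering is built from its last vertex: pick a vertex with fewer than k
    neighbours in the set at hand, put it last, and order the rest. *)
Lemma degenerate_col_bound k :
    (forall S : {set T}, S != set0 ->
       exists2 v, v \in S & (#|[set u in S | e u v]| < k)%N) ->
  col_bound e k.
Proof.
move=> degen.
suff /(_ _ [set: T] erefl) [s [us sT sk]] : forall n (S : {set T}), #|S| = n ->
    exists s : seq T, [/\ uniq s, s =i S & forall v, v \in S ->
      (#|[set u | e u v & (index u s < index v s)%N]| < k)%N].
  have ss : size s == #|T| by rewrite -(card_uniqP us) (eq_card sT) cardsT.
  apply/existsP; exists (Tuple ss); rewrite /linear_ordering us /=.
  by apply/forallP => v; apply: sk; rewrite inE.
elim=> [|n IHn] S Sn.
  by exists [::]; split=> // v; rewrite ?(cards0_eq Sn) inE.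
have [|v vS vk] := degen S; first by rewrite -card_gt0 Sn.
have [|s [us sS sk]] := IHn (S :\ v).
  by move: Sn; rewrite (cardsD1 v) vS => -[].
have vNs : v \notin s by rewrite sS !inE eqxx.
exists (rcons s v); split=> [|u|w wS]; first by rewrite rcons_uniq vNs.
  by rewrite mem_rcons inE sS !inE; case: eqVneq => [->|].
have idx u : index u (rcons s v) =
    if u \in s then index u s else (size s + (v != u))%N.
  by rewrite -cats1 index_cat /= ; case: (v == u).
have [wv|Nwv] := eqVneq w v.
  apply: leq_ltn_trans vk; apply: subset_leq_card; apply/subsetP => u.
  rewrite !inE {w wS}wv !idx (negPf vNs) eqxx /= addn0 => /andP[->].
  case: ifP => [us'|_]; last by rewrite ltnNge leq_addr.
  by move: us'; rewrite sS !inE => /andP[_ ->].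
have ws : w \in s by rewrite sS !inE Nwv.
apply: leq_ltn_trans (sk w _); last by rewrite !inE Nwv.
apply: subset_leq_card; apply/subsetP => u; rewrite !inE !idx ws.
case/andP => -> /=; case: ifP => // _ lt.
have iw : (index w s <= size s)%N := index_size w s.
by move: lt; rewrite ltnNge (leq_trans iw) ?leq_addr.
Qed.

(** As k is not a bound for the coloring number, some nonempty S has minimum
    degree at least k inside S; S contains a vertex with k neighbours, so it has
    more than k elements, and their degrees already add up to (k + 1) k. *)
Lemma coloring_number_edges k : coloring_number e = k.+1 ->
  (k.+1 * k <= 2 * #|edges e|)%N.
Proof.
rewrite /coloring_number; case: ex_minnP => c _ cmin ck.
have Nk : ~~ col_bound e k by apply: contraT => /negPn/cmin; rewrite ck ltnn.
rewrite leqNgt; apply: contraNN Nk => small.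
apply: degenerate_col_bound => S S0; apply/exists_inP; apply: contraLR small.
rewrite negb_exists_in -leqNgt => /forall_inP kS.
have {}kS v : v \in S -> (k <= #|[set u in S | e u v]|)%N.
  by move=> /kS; rewrite -leqNgt.
have cS : (k < #|S|)%N.
  have /set0Pn[v vS] := S0; apply: leq_ltn_trans (kS v vS) _.
  apply: proper_card; apply/properP; split.
    by apply/subsetP => u; rewrite inE => /andP[].
  by exists v; rewrite // inE e_irr andbF.
rewrite -sum_deg; apply: (@leq_trans (\sum_(v in S) k)).
  by rewrite sum_nat_const leq_mul2r cS orbT.
rewrite [leqRHS](bigID (mem S)) /=; apply: leq_trans (leq_addr _ _).
apply: leq_sum => v vS; apply: leq_trans (kS v vS) _.
by apply: subset_leq_card; apply/subsetP => u; rewrite !inE e_sym => /andP[].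
Qed.

Lemma coloring_number_gt1 : (0 < #|edges e|)%N -> (1 < coloring_number e)%N.
Proof.
case/card_gt0P => E; rewrite inE => /existsP[u /existsP[v /andP[uv _]]].
rewrite /coloring_number; case: ex_minnP => -[|[|k]] // kb _; exfalso.
  by case/existsP: kb => s /andP[_ /forallP/(_ u)].
by have [c /(_ u v uv)] := greedy_coloring kb; rewrite !ord1 eqxx.
Qed.

(** * Spectral bounds for graphs *)

Variable R : rcfType.

Lemma adjmx_sym : (adjmx e R)^T = adjmx e R.
Proof. by apply/matrixP => i j; rewrite !mxE e_sym. Qed.

Lemma sum_adjmx (F : T -> T -> R) :
  \sum_i \sum_j adjmx e R i j * F (enum_val i) (enum_val j)
    = \sum_u \sum_(v | e u v) F u v.
Proof.
rewrite [RHS](reindex (@enum_val T T)) /=; last first.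
  exact: onW_bij (enum_val_bij T).
apply: eq_bigr => i _.
rewrite [RHS](reindex (@enum_val T T)) /=; last first.
  exact: onW_bij (enum_val_bij T).
rewrite [RHS]big_mkcond; apply: eq_bigr => j _; rewrite mxE.
by case: (e _ _); rewrite (mul1r, mul0r).
Qed.

Lemma sum_arcs1 : \sum_u \sum_(v | e u v) 1 = 2 * #|edges e|%:R :> R.
Proof. by rewrite (sum_arcs (fun=> 1)) sumr_const mulr_natl. Qed.

Lemma splus_le_ando_lin k : (1 < k)%N -> col_bound e k ->
  k%:R * splus R e <= (k%:R - 1) * (2 * #|edges e|%:R).
Proof.
case: k => // k k1 /greedy_coloring[c cP].
have := ando_lin adjmx_sym (c := c \o enum_val) k1 _; rewrite -/(splus R e).
have -> : \sum_i \sum_j adjmx e R i j ^+ 2 = 2 * #|edges e|%:R.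
  rewrite -sum_arcs1 -sum_adjmx; apply: eq_bigr => i _; apply: eq_bigr => j _.
  by rewrite mxE; case: (e _ _); rewrite ?expr1n ?expr0n ?mulr1.
apply=> i j cij; rewrite mxE; case: (boolP (e _ _)) => // /cP.
by rewrite -[c _]/((c \o enum_val) i) cij eqxx.
Qed.

Lemma sqr_coloring_number_splus : (0 < #|edges e|)%N ->
  (coloring_number e)%:R ^+ 2 * splus R e <= (2 * #|edges e|%:R) ^+ 2.
Proof.
move=> /coloring_number_gt1.
have kb : col_bound e (coloring_number e).
  by rewrite /coloring_number; case: ex_minnP.
have := coloring_number_edges; move: kb; case: (coloring_number e) => // k kb.
move=> /(_ k erefl); rewrite -(ler_nat R) !natrM => leE k1.
have := splus_le_ando_lin k1 kb; set K := k.+1%:R => leS.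
have K0 : 0 <= K by rewrite ler0n.
have Kk : K - 1 = k%:R by rewrite /K -natr1 addrK.
rewrite -Kk -/K in leE.
rewrite expr2 -mulrA; apply: le_trans (ler_wpM2l K0 leS) _.
by rewrite [leLHS]mulrA [leRHS]expr2 ler_wpM2r // mulr_ge0.
Qed.

Lemma edge_weight u v : e u v ->
  Num.sqrt (\prod_(w in [set u; v]) (deg e w)%:R) =
  Num.sqrt (deg e u)%:R * Num.sqrt (deg e v)%:R :> R.
Proof.
move=> uv; have Nuv : u != v by apply: contraTneq uv => ->; rewrite e_irr.
by rewrite big_setU1 ?inE //= big_set1 sqrtrM.
Qed.

(** The Rayleigh quotient at the vector with entries sqrt(d(u)), whose squared
    length is the sum 2m of all degrees. *)
Lemma sum_arcs_weight_le_mu :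
  \sum_u \sum_(v | e u v) Num.sqrt (deg e u)%:R * Num.sqrt (deg e v)%:R
    <= mu R e * (2 * #|edges e|%:R).
Proof.
have := rayleigh_le adjmx_sym (fun i => Num.sqrt (deg e (enum_val i))%:R).
rewrite -/(mu R e).
have -> : \sum_(i < #|T|) Num.sqrt (deg e (enum_val i))%:R ^+ 2 =
    2 * #|edges e|%:R :> R.
  rewrite -natrM -sum_deg natr_sum.
  rewrite [RHS](reindex (@enum_val T T)) /=; last first.
    exact: onW_bij (enum_val_bij T).
  by apply: eq_bigr => i _; rewrite sqr_sqrtr.
apply: le_trans; rewrite -sum_adjmx le_eqVlt; apply/orP; left; apply/eqP.
by apply: eq_bigr => i _; apply: eq_bigr => j _; ring.
Qed.

Lemma deg_gt0 u v : e u v -> (0 < deg e u)%N.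
Proof. by move=> uv; apply/card_gt0P; exists v; rewrite inE. Qed.

Lemma mu_gt0 : (0 < #|edges e|)%N -> 0 < mu R e.
Proof.
move=> m0; have m1 : 0 < 2 * #|edges e|%:R :> R by rewrite mulr_gt0 ?ltr0n.
rewrite -(pmulr_lgt0 _ m1); apply: lt_le_trans sum_arcs_weight_le_mu.
have /card_gt0P[E] := m0; rewrite inE => /existsP[u /existsP[v /andP[uv _]]].
have ge0 a b : 0 <= Num.sqrt (deg e a)%:R * Num.sqrt (deg e b)%:R :> R.
  by rewrite mulr_ge0 ?sqrtr_ge0.
rewrite (bigD1 u) //= (bigD1 v) //= -addrA ltr_wpDr //.
  by rewrite addr_ge0 ?sumr_ge0 // => a _; rewrite sumr_ge0.
have vu : e v u by rewrite e_sym.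
by rewrite mulr_gt0 // sqrtr_gt0 ltr0n; [apply: deg_gt0 uv|apply: deg_gt0 vu].
Qed.

(** The weighted inequality (q - mu)^2 / q >= 0, summed over ordered pairs of
    adjacent vertices, plays the role of Cauchy-Schwarz between the sums of q
    and of 1 / q; the weight mu is the one that lets the bound on the sum of q
    be used directly. *)
Lemma edges_le_mu_randic : (0 < #|edges e|)%N ->
  #|edges e|%:R <= mu R e * randic e R.
Proof.
move=> /mu_gt0 m0; set m := #|edges e|%:R; set t := mu R e.
pose q u v : R := Num.sqrt (deg e u)%:R * Num.sqrt (deg e v)%:R.
have randicE : \sum_u \sum_(v | e u v) (q u v)^-1 = 2 * randic e R.
  rewrite mulr_natl -sum_arcs; apply: eq_bigr => u _; apply: eq_bigr => v uv.
  by rewrite edge_weight.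
suff : 0 <= t * (2 * m) - 2 * t * (2 * m) + t ^+ 2 * (2 * randic e R).
  have -> : t * (2 * m) - 2 * t * (2 * m) + t ^+ 2 * (2 * randic e R) =
    2 * t * (t * randic e R - m) by ring.
  by rewrite pmulr_rge0 ?mulr_gt0 // subr_ge0.
have := sum_arcs_weight_le_mu; rewrite -/m -/t -subr_ge0 => le_mu.
suff : 0 <= \sum_u \sum_(v | e u v) (q u v - 2 * t + t ^+ 2 * (q u v)^-1).
  have -> : \sum_u \sum_(v | e u v) (q u v - 2 * t + t ^+ 2 * (q u v)^-1) =
      \sum_u \sum_(v | e u v) q u v - 2 * t * (2 * m)
        + t ^+ 2 * (2 * randic e R).
    rewrite -randicE -[2 * m]sum_arcs1 !mulr_sumr -sumrB -big_split.
    apply: eq_bigr => u _; rewrite !mulr_sumr -sumrB -big_split /=.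
    by apply: eq_bigr => v _; rewrite mulr1.
  rewrite subr_ge0 in le_mu; move=> /le_trans; apply.
  by rewrite lerD2r lerD2r.
rewrite sumr_ge0 // => u _; rewrite sumr_ge0 // => v uv.
have q0 : 0 < q u v.
  rewrite /q mulr_gt0 // sqrtr_gt0 ltr0n; first exact: deg_gt0 uv.
  by apply: (@deg_gt0 v u); rewrite e_sym.
have -> : q u v - 2 * t + t ^+ 2 * (q u v)^-1 = (q u v - t) ^+ 2 / q u v.
  by field; rewrite gt_eqF.
by rewrite divr_ge0 ?sqr_ge0 ?ltW.
Qed.

Lemma mu_le_sqrt_splus : 0 < mu R e -> mu R e <= Num.sqrt (splus R e).
Proof.
rewrite /mu /splus; case: (spectrum _) => [|x s] /=; first by rewrite ltxx.
move=> x0; rewrite -[leLHS](gtr0_norm x0) -sqrtr_sqr ler_sqrt; last first.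
  by rewrite sumr_ge0 // => y _; rewrite sqr_ge0.
by rewrite big_cons x0 lerDl sumr_ge0 // => y _; rewrite sqr_ge0.
Qed.

End Graph.

Theorem theorem3p3 (R : rcfType) (T : finType) (e : rel T)
    (e_sym : symmetric e) (e_irr : irreflexive e) (m : nat)
    (m_def : m = #|edges e|) (m_ge1 : (1 <= m)%N) :
  [/\ (coloring_number e)%:R <= 2 * m%:R / Num.sqrt (splus R e),
      2 * m%:R / Num.sqrt (splus R e) <= 2 * m%:R / mu R e
    & 2 * m%:R / mu R e <= 2 * randic e R].
Proof.
rewrite m_def in m_ge1 *.
have mu0 : 0 < mu R e := mu_gt0 e_sym e_irr R m_ge1.
have le_mu_s := mu_le_sqrt_splus mu0.
have s0 : 0 < Num.sqrt (splus R e) := lt_le_trans mu0 le_mu_s.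
split.
- rewrite ler_pdivlMr // -ler_sqr ?nnegrE ?mulr_ge0 ?sqrtr_ge0 //.
  rewrite exprMn sqr_sqrtr; first exact: sqr_coloring_number_splus.
  by rewrite ltW // -sqrtr_gt0.
- by rewrite ler_wpM2l ?mulr_ge0 // lef_pV2.
- by rewrite ler_pdivrMr // -mulrA ler_wpM2l // mulrC edges_le_mu_randic.
Qed.
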